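(* Suppose $\lambda_1=0$ and $\beta$ satisfies condition $(E)$. Let $\varphi$ be an entire function and $C_\varphi f=f\circ\varphi$. Then $C_\varphi$ is a bounded operator from $\mathcal{H}(E,\beta)$ into itself if and only if either (i) $\varphi$ is constant, or (ii) $\varphi(z)=z+b$ for some $b\in\mathbb{C}$ with $\operatorname{Re}(b)\ge0$. Moreover, $\|C_\varphi\|\ge1$ in case (i), and $\|C_\varphi\|=1$ in case (ii).
   Context: Fix a sequence $\Lambda=(\lambda_n)_{n\ge1}$ of real numbers with $0\le\lambda_1<\lambda_2<\cdots$ and $\lambda_n\to+\infty$, such that $\limsup_{n\to\infty}\frac{\log n}{\lambda_n}<+\infty$. For a sequence $\beta=(\beta_n)$ of positive reals, condition $(E)$ is: $\liminf_{n\to\infty}\frac{\log\beta_n}{\lambda_n}=+\infty$. Under $(E)$, $\mathcal{H}(E,\beta)$ denotes the Hilbert space of entire functions $f(z)=\sum_{n=1}^\infty a_ne^{-\lambda_nz}$ ($a_n\in\mathbb{C}$; the representation is unique) with norm $\|f\|=\big(\sum_{n=1}^\infty|a_n|^2\beta_n^2\big)^{1/2}<\infty$. When $\lambda_1=0$ this space contains the constant functions. *)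

(* Defs.v *)
From Stdlib Require Import Reals Lra.
Open Scope R_scope.

Definition Cplx := (R * R)%type.
Definition Re (z : Cplx) : R := fst z.
Definition Im (z : Cplx) : R := snd z.
Definition Cadd (z w : Cplx) : Cplx := (Re z + Re w, Im z + Im w).
Definition Csub (z w : Cplx) : Cplx := (Re z - Re w, Im z - Im w).
Definition Cmul (z w : Cplx) : Cplx :=
  (Re z * Re w - Im z * Im w, Re z * Im w + Im z * Re w).
Definition Cnorm2 (z : Cplx) : R := Re z * Re z + Im z * Im z.
Definition Cnorm (z : Cplx) : R := sqrt (Cnorm2 z).

Definition Cexp_neg (l : R) (z : Cplx) : Cplx :=
  (exp (- l * Re z) * cos (l * Im z), - (exp (- l * Re z) * sin (l * Im z))).

Definition entire (phi : Cplx -> Cplx) : Prop :=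
  forall z : Cplx, exists l : Cplx, forall eps : R, 0 < eps -> exists delta : R, 0 < delta /\
    forall h : Cplx, Cnorm h < delta ->
      Cnorm (Csub (Csub (phi (Cadd z h)) (phi z)) (Cmul l h)) <= eps * Cnorm h.

(* Standing hypotheses on Lambda = (lambda_n)_{n>=1}; lam k stands for lambda_{k+1}. *)
Definition frequencies (lam : nat -> R) : Prop :=
  0 <= lam 0%nat /\
  (forall n, lam n < lam (S n)) /\
  cv_infty lam /\
  (* limsup log n / lambda_n < +infinity *)
  (exists M : R, exists N0 : nat, forall n, (N0 <= n)%nat ->
      ln (INR (S n)) / lam n <= M).

(* condition (E): liminf log beta_n / lambda_n = +infinity *)
Definition condE (lam beta : nat -> R) : Prop :=
  (forall n, 0 < beta n) /\
  forall M : R, exists N0 : nat, forall n, (N0 <= n)%nat -> M <= ln (beta n) / lam n.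

Fixpoint dpartial (lam : nat -> R) (a : nat -> Cplx) (z : Cplx) (N : nat) : Cplx :=
  match N with
  | O => Cmul (a O) (Cexp_neg (lam O) z)
  | S k => Cadd (dpartial lam a z k) (Cmul (a (S k)) (Cexp_neg (lam (S k)) z))
  end.

Definition dirichlet_rep (lam : nat -> R) (f : Cplx -> Cplx) (a : nat -> Cplx) : Prop :=
  forall z : Cplx,
    Un_cv (fun N => Re (dpartial lam a z N)) (Re (f z)) /\
    Un_cv (fun N => Im (dpartial lam a z N)) (Im (f z)).

(* sum_n |a_n|^2 beta_n^2 = s  (so the H(E,beta)-norm is sqrt s) *)
Definition coef_normsq (beta : nat -> R) (a : nat -> Cplx) (s : R) : Prop :=
  infinite_sum (fun n => Cnorm2 (a n) * (beta n) ^ 2) s.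

Definition inH (lam beta : nat -> R) (f : Cplx -> Cplx) : Prop :=
  exists a s, dirichlet_rep lam f a /\ coef_normsq beta a s.

Definition comp_bounded (lam beta : nat -> R) (phi : Cplx -> Cplx) : Prop :=
  (forall f, inH lam beta f -> inH lam beta (fun z => f (phi z))) /\
  exists K : R, forall f a s b t,
    dirichlet_rep lam f a -> coef_normsq beta a s ->
    dirichlet_rep lam (fun z => f (phi z)) b -> coef_normsq beta b t ->
    sqrt t <= K * sqrt s.

(* the set { ||C_phi f|| / ||f|| : f in H, f <> 0 }; its lub is ||C_phi|| *)
Definition comp_ratios (lam beta : nat -> R) (phi : Cplx -> Cplx) (r : R) : Prop :=
  exists f a s b t,
    dirichlet_rep lam f a /\ coef_normsq beta a s /\ 0 < s /\
    dirichlet_rep lam (fun z => f (phi z)) b /\ coef_normsq beta b t /\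
    r = sqrt t / sqrt s.

Definition is_constant (phi : Cplx -> Cplx) : Prop := exists c : Cplx, forall z, phi z = c.

Definition is_translation (phi : Cplx -> Cplx) : Prop :=
  exists b : Cplx, 0 <= Re b /\ forall z, phi z = Cadd z b.

(* Main.v *)
(* The reproducing kernel at w has squared norm W(Re w), where W(x) = sum_n e^(-2 lam_n x)
   / beta_n^2. If C_phi is bounded by K, testing it on kernels gives W(Re (phi w)) <= K^2
   W(Re w), and comparing the two series yields Re (phi w) >= Re w - D as soon as Re w is
   negative enough. Hence g = e^(-lam_1 phi), which is in the space, is O(e^(-lam_1 Re z))
   as Re z -> -oo. A Dirichlet series satisfies |b_n| e^(-lam_n x) <= sup_y |g(x + iy)|, so
   only the frequencies 0 and lam_1 survive: g = b_0 + b_1 e^(-lam_1 z). Being an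
   exponential, g has no zero, so b_0 = 0 or b_1 = 0, and phi is a translation or a
   constant by continuity; testing on e^(-lam_k z) for large k gives Re b >= 0. The
   coefficient estimate also yields the uniqueness of coefficients, on which the norm
   computations in both cases rest. Indices start at 0, so that lam_0 = 0. *)

From Stdlib Require Import Reals Lra Lia.
From Coquelicot Require Import Coquelicot.
Require Import Defs.
Open Scope R_scope.

(** * Real inequalities and series *)

Lemma exp_le x y : x <= y -> exp x <= exp y.
Proof. intros [H| ->]; [ left; now apply exp_increasing | lra ]. Qed.

Lemma exp_dominated_le_0 (m A k r : R) :
  0 < k -> (forall x, x <= r -> m <= A * exp (k * x)) -> m <= 0.
Proof.
  intros Hk Hdom. apply Rnot_lt_le. intros Hm.
  assert (HA : 0 < A).
  { specialize (Hdom r (Rle_refl r)). generalize (exp_pos (k * r)). nra. }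
  assert (Hq : 0 < m / (2 * A)) by (apply Rdiv_lt_0_compat; lra).
  set (x := Rmin r (ln (m / (2 * A)) / k)).
  assert (Hx : x * k <= ln (m / (2 * A))) by (apply Rle_div_r; [ easy | apply Rmin_r ]).
  apply exp_le in Hx. rewrite exp_ln, Rmult_comm in Hx by easy.
  apply (Rmult_le_compat_l A) in Hx; [ | lra ].
  replace (A * (m / (2 * A))) with (m / 2) in Hx by (field; lra).
  specialize (Hdom x (Rmin_l _ _)). lra.
Qed.

Lemma sum_n_finite_support {G : AbelianMonoid} (a : nat -> G) N n :
  (forall k, (N < k)%nat -> a k = zero) -> (N <= n)%nat -> sum_n a n = sum_n a N.
Proof.
  intros Ha. induction 1 as [|n Hn IH]; [ easy | ].
  now rewrite sum_Sn, IH, Ha, plus_zero_r by lia.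
Qed.

Lemma sum_n_single {G : AbelianMonoid} (a : nat -> G) n N :
  (n <= N)%nat -> (forall k, (k <= N)%nat -> k <> n -> a k = zero) -> sum_n a N = a n.
Proof.
  induction N as [|N IH]; intros Hn Ha.
  - replace n with 0%nat by lia. apply sum_O.
  - rewrite sum_Sn. destruct (Nat.eq_dec n (S N)) as [->|Hne].
    + rewrite (sum_n_ext_loc a (fun _ => zero)) by (intros k Hk; apply Ha; lia).
      unfold sum_n. rewrite sum_n_m_const_zero. apply plus_zero_l.
    + rewrite IH, (Ha (S N)) by (lia || (intros k Hk; apply Ha; lia)).
      apply plus_zero_r.
Qed.

Section SeriesInNormedModules.

Context {K : AbsRing} {V : NormedModule K}.
Implicit Types (a : nat -> V) (l : V).

Lemma is_series_limit_unique a l l' : is_series a l -> is_series a l' -> l = l'.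
Proof. apply (filterlim_locally_unique (F := eventually)). Qed.

Lemma is_series_finite_support a N :
  (forall k, (N < k)%nat -> a k = zero) -> is_series a (sum_n a N).
Proof.
  intros Ha. apply filterlim_ext_loc with (fun _ => sum_n a N).
  - exists N. intros n Hn. symmetry. now apply sum_n_finite_support.
  - apply filterlim_const.
Qed.

Lemma is_series_single a n : (forall k, k <> n -> a k = zero) -> is_series a (a n).
Proof.
  intros Ha. rewrite <- (sum_n_single a n n) by auto.
  apply is_series_finite_support. intros k Hk. apply Ha. lia.
Qed.

Lemma is_series_tail a l N :
  is_series a l -> is_series (fun k => a (S N + k)%nat) (minus l (sum_n a N)).
Proof.
  intros Ha. apply (is_series_incr_n a (S N)); [ lia | ]. unfold minus. simpl Nat.pred.
  rewrite <- plus_assoc.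
  replace (plus (opp _) _) with (@zero V) by (exact (eq_sym (plus_opp_l (sum_n a N)))).
  now rewrite plus_zero_r.
Qed.

Lemma is_series_norm_le a (b : nat -> R) l (L : R) :
  (forall n, norm (a n) <= b n) -> is_series a l -> is_series b L -> norm l <= L.
Proof.
  intros Hab Ha Hb.
  apply (filterlim_le (F := eventually) (fun n => norm (sum_n a n)) (sum_n b) (norm l) L).
  - exists 0%nat. intros n _. unfold sum_n.
    eapply Rle_trans; [ apply norm_sum_n_m | ]. now apply sum_n_m_le.
  - eapply filterlim_comp; [ exact Ha | apply filterlim_norm ].
  - exact Hb.
Qed.

End SeriesInNormedModules.

Lemma sum_f_R0_le_Series (u : nat -> R) N :
  (forall n, 0 <= u n) -> ex_series u -> sum_f_R0 u N <= Series u.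
Proof.
  intros Hu He. apply (sum_incr u N (Series u)); [ | easy ].
  apply is_series_Reals, Series_correct, He.
Qed.

Lemma ex_series_nonneg_le (u v : nat -> R) :
  (forall n, 0 <= u n <= v n) -> ex_series v -> ex_series u.
Proof.
  intros Huv. apply (@ex_series_le R_AbsRing R_CompleteNormedModule).
  intros n. change (norm (u n)) with (Rabs (u n)). rewrite Rabs_pos_eq; apply Huv.
Qed.

Lemma Series_tail_small (u : nat -> R) n eps :
  ex_series u -> 0 < eps ->
  exists N, (n <= N)%nat /\ Series (fun k => u (S N + k)%nat) <= eps.
Proof.
  intros Hu He.
  destruct (proj1 (is_series_Reals u (Series u)) (Series_correct u Hu) eps He) as [N HN].
  exists (n + N)%nat. split; [ lia | ].
  specialize (HN (n + N)%nat ltac:(lia)). unfold Rdist in HN.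
  rewrite (Series_incr_n u (S (n + N))) in HN by (easy || lia).
  apply Rabs_def2 in HN. simpl Nat.pred in HN. lra.
Qed.

Lemma is_series_telescope (u : nat -> R) (l : R) :
  is_lim_seq u l -> is_series (fun n => u n - u (S n)) (u 0%nat - l).
Proof.
  intros Hu.
  assert (Hsum : forall n, u 0%nat - u (S n) = sum_n (fun n => u n - u (S n)) n).
  { induction n as [|n IH]; [ now rewrite sum_O | ].
    rewrite sum_Sn, <- IH. unfold plus; simpl. ring. }
  apply (is_lim_seq_ext _ _ (u 0%nat - l) Hsum), is_lim_seq_minus'.
  - apply is_lim_seq_const.
  - now apply (is_lim_seq_incr_1 u).
Qed.

Lemma ex_series_inv_sqr : ex_series (fun n => (/ INR (S n)) ^ 2).
Proof.
  apply ex_series_incr_1.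
  apply ex_series_nonneg_le with (fun n => / INR (S n) - / INR (S (S n))).
  - intros n. split; [ apply pow2_ge_0 | ].
    assert (Hn := pos_INR n). rewrite !S_INR. apply Rminus_le.
    assert (Hpos : 0 < / ((INR n + 1) * (INR n + 1 + 1) ^ 2))
      by (apply Rinv_0_lt_compat, Rmult_lt_0_compat; [ lra | nra ]).
    replace (_ - _) with (- / ((INR n + 1) * (INR n + 1 + 1) ^ 2)) by (field; lra). lra.
  - exists (/ INR 1 - 0). apply (is_series_telescope (fun n => / INR (S n))).
    apply (is_lim_seq_incr_1 (fun n => / INR n)).
    apply (is_lim_seq_inv INR p_infty); [ apply is_lim_seq_INR | easy ].
Qed.

Lemma quadratic_nonneg_discriminant (a b c : R) :
  0 <= a -> (forall x, 0 <= a * x ^ 2 + 2 * b * x + c) -> b ^ 2 <= a * c.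
Proof.
  intros [Ha| <-] Hq.
  - specialize (Hq (- b / a)).
    replace (_ + c) with ((a * c - b ^ 2) / a) in Hq by (field; lra).
    apply Rmult_le_compat_r with (r := a) in Hq; [ | lra ].
    replace ((a * c - b ^ 2) / a * a) with (a * c - b ^ 2) in Hq by (field; lra). lra.
  - destruct (Req_dec b 0) as [->|Hb]; [ lra | ].
    specialize (Hq (- (c + 1) / (2 * b))).
    replace (_ + c) with (- 1) in Hq by (field; easy). lra.
Qed.

Section CauchySchwarz.

Variables u v : nat -> R.
Hypothesis u_sqr : ex_series (fun n => u n ^ 2).
Hypothesis v_sqr : ex_series (fun n => v n ^ 2).

Lemma ex_series_mult_sqr : ex_series (fun n => u n * v n).
Proof.
  apply (@ex_series_le R_AbsRing R_CompleteNormedModule) with (fun n => u n ^ 2 + v n ^ 2).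
  - intros n. change (norm ?w) with (Rabs w). apply Rabs_le.
    generalize (pow2_ge_0 (u n - v n)) (pow2_ge_0 (u n + v n)). nra.
  - now apply (ex_series_plus (V := R_NormedModule)).
Qed.

Lemma Series_Cauchy_Schwarz :
  Series (fun n => u n * v n) <=
  sqrt (Series (fun n => u n ^ 2)) * sqrt (Series (fun n => v n ^ 2)).
Proof.
  assert (Series_sqr_nonneg : forall w, ex_series (fun n => w n ^ 2) ->
    0 <= Series (fun n => w n ^ 2)).
  { intros w Hw. eapply Rle_trans; [ apply (pow2_ge_0 (w 0%nat)) | ].
    apply (sum_f_R0_le_Series (fun n => w n ^ 2) 0); [ intros; apply pow2_ge_0 | easy ]. }
  assert (Huv := ex_series_mult_sqr).
  rewrite <- sqrt_mult by now apply Series_sqr_nonneg.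
  eapply Rle_trans; [ apply Rle_abs | ]. rewrite <- sqrt_Rsqr_abs, Rsqr_pow2.
  apply sqrt_le_1_alt, quadratic_nonneg_discriminant; [ now apply Series_sqr_nonneg | ].
  intros x.
  assert (Hexpand : is_series (fun n => (x * u n + v n) ^ 2)
    (x ^ 2 * Series (fun n => u n ^ 2) + 2 * x * Series (fun n => u n * v n)
     + Series (fun n => v n ^ 2))).
  { apply is_series_ext with
      (fun n => x ^ 2 * u n ^ 2 + 2 * x * (u n * v n) + v n ^ 2); [ intros n; simpl; ring | ].
    repeat apply (is_series_plus (V := R_NormedModule));
      try apply (is_series_scal_l (V := R_NormedModule)); now apply Series_correct. }
  assert (Hnonneg := Series_sqr_nonneg (fun n => x * u n + v n) (ex_intro _ _ Hexpand)).
  cbv beta in Hnonneg.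
  rewrite (is_series_unique _ _ Hexpand) in Hnonneg. lra.
Qed.

End CauchySchwarz.

(* [ring] and [field] are registered for [C], but equations often come at the convertible types
   [Cplx] and [NormedModule.sort C_NormedModule]. *)
Ltac at_C := simpl; match goal with |- @eq _ ?u ?v => change (@eq C u v) end.

Lemma is_series_RtoC (u : nat -> R) (l : R) :
  is_series u l -> is_series (V := C_NormedModule) (fun n => RtoC (u n)) (RtoC l).
Proof.
  intros Hu.
  apply (filterlim_ext (fun N => RtoC (sum_n u N))).
  - induction x as [|N IH]; [ now rewrite !sum_O | ].
    rewrite !sum_Sn, <- IH. apply RtoC_plus.
  - eapply filterlim_comp; [ exact Hu | ].
    apply filterlim_locally. intros eps. exists eps. intros x Hx.
    split; [ exact Hx | apply ball_center ].
Qed.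

(** * The exponentials [e^(-l z)] *)

Lemma Cmod_Cexp_neg (l : R) (z : C) : Cmod (Cexp_neg l z) = exp (- l * Re z).
Proof.
  unfold Cmod, Cexp_neg. simpl fst. simpl snd.
  replace (_ ^ 2 + _ ^ 2)
    with (exp (- l * Re z) ^ 2 * (Rsqr (sin (l * Im z)) + Rsqr (cos (l * Im z))))
    by (unfold Rsqr; ring).
  rewrite sin2_cos2, Rmult_1_r.
  apply sqrt_pow2. left; apply exp_pos.
Qed.

Lemma Cexp_neg_plus (l : R) (z w : C) :
  Cexp_neg l (z + w)%C = (Cexp_neg l z * Cexp_neg l w)%C.
Proof.
  unfold Cexp_neg, Cmult, Cplus, Re, Im; simpl.
  rewrite !Rmult_plus_distr_l, exp_plus, cos_plus, sin_plus.
  f_equal; ring.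
Qed.

Lemma Cexp_neg_freq_plus (l m : R) (z : C) :
  Cexp_neg (l + m) z = (Cexp_neg l z * Cexp_neg m z)%C.
Proof.
  unfold Cexp_neg, Cmult, Re, Im; simpl.
  rewrite Ropp_plus_distr, !Rmult_plus_distr_r, exp_plus, cos_plus, sin_plus.
  f_equal; ring.
Qed.

Lemma Cexp_neg_freq_0 (z : C) : Cexp_neg 0 z = RtoC 1.
Proof.
  unfold Cexp_neg. rewrite Ropp_0, !Rmult_0_l, exp_0, cos_0, sin_0.
  unfold RtoC. f_equal; ring.
Qed.

Lemma Cexp_neg_neq_0 (l : R) (z : C) : Cexp_neg l z <> RtoC 0.
Proof. apply Cmod_gt_0. rewrite Cmod_Cexp_neg. apply exp_pos. Qed.

Lemma Cexp_neg_conj_mult (l : R) (z : C) :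
  (Cconj (Cexp_neg l z) * Cexp_neg l z)%C = RtoC (exp (- l * Re z) ^ 2).
Proof. rewrite <- Cmod_Cexp_neg, Cmod2_conj. apply Cmult_comm. Qed.

Lemma Cnorm2_Cmod (z : C) : Cnorm2 z = Cmod z ^ 2.
Proof. rewrite Cmod2_alt. unfold Cnorm2, Re, Im, Complex.Re, Complex.Im. ring. Qed.

Lemma Cnorm_Cmod (z : C) : Cnorm z = Cmod z.
Proof. unfold Cnorm. rewrite Cnorm2_Cmod. apply sqrt_pow2, Cmod_ge_0. Qed.

Lemma C_polar (c : C) : exists th, c = (RtoC (Cmod c) * (cos th, sin th))%C.
Proof.
  destruct (Ceq_dec c 0) as [->|Hc]; [ exists 0; rewrite Cmod_0; now rewrite Cmult_0_l | ].
  assert (Hr : 0 < Cmod c) by now apply Cmod_gt_0.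
  set (r := Cmod c) in *. set (p := fst c / r). set (q := snd c / r).
  assert (Hpq : p ^ 2 + q ^ 2 = 1).
  { assert (Hrr : r ^ 2 = fst c ^ 2 + snd c ^ 2) by exact (Cmod2_alt c).
    unfold p, q. replace (_ + _) with ((fst c ^ 2 + snd c ^ 2) / r ^ 2) by (field; lra).
    rewrite <- Hrr. field. lra. }
  assert (Hp : -1 <= p <= 1) by nra.
  assert (Hsin : sin (acos p) = Rabs q).
  { rewrite sin_acos by easy. rewrite <- sqrt_Rsqr_abs. f_equal. unfold Rsqr. lra. }
  assert (Hth : exists th, cos th = p /\ sin th = q).
  { destruct (Rle_lt_dec 0 q).
    - exists (acos p). rewrite cos_acos, Hsin, Rabs_pos_eq by easy. easy.
    - exists (- acos p). rewrite cos_neg, sin_neg, cos_acos, Hsin, Rabs_left by lra. lra. }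
  destruct Hth as [th [Hcos Hsinq]]. exists th. rewrite Hcos, Hsinq.
  unfold p, q, RtoC, Cmult. destruct c; simpl. f_equal; field; lra.
Qed.

Lemma Cexp_neg_surj (l : R) (c : C) :
  l <> 0 -> c <> RtoC 0 -> exists z, Cexp_neg l z = c.
Proof.
  intros Hl Hc. destruct (C_polar c) as [th Hth].
  exists (- ln (Cmod c) / l, - th / l). rewrite Hth at 2.
  unfold Cexp_neg, Cmult, RtoC, Re, Im; simpl.
  replace (- l * (- ln (Cmod c) / l)) with (ln (Cmod c)) by (field; lra).
  replace (l * (- th / l)) with (- th) by (field; lra).
  rewrite exp_ln, cos_neg, sin_neg by now apply Cmod_gt_0.
  f_equal; ring.
Qed.

Lemma Cexp_neg_eq_inv (l : R) (z w : C) :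
  l <> 0 -> Cexp_neg l z = Cexp_neg l w ->
  Re z = Re w /\ cos (l * (Im w - Im z)) = 1.
Proof.
  intros Hl E.
  assert (HRe : Re z = Re w).
  { apply Rmult_eq_reg_l with (- l); [ | lra ].
    apply exp_inv. now rewrite <- !Cmod_Cexp_neg, E. }
  split; [ easy | ].
  unfold Cexp_neg in E. rewrite HRe in E.
  assert (Hpos := exp_pos (- l * Re w)). injection E as Ecos Esin.
  apply Rmult_eq_reg_l in Ecos; [ | lra ].
  apply Ropp_eq_compat in Esin. rewrite !Ropp_involutive in Esin.
  apply Rmult_eq_reg_l in Esin; [ | lra ].
  rewrite Rmult_minus_distr_l, cos_minus, Ecos, Esin, Rplus_comm.
  exact (sin2_cos2 (l * Im w)).
Qed.

Definition C_continuous (psi : C -> C) : Prop :=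
  forall z : C, continuous (T := C_UniformSpace) (U := C_UniformSpace) psi z.

Lemma entire_continuous (phi : C -> C) : entire phi -> C_continuous phi.
Proof.
  intros Hphi z. destruct (Hphi z) as [l Hl]. destruct (Hl 1 Rlt_0_1) as [d [Hd Hlin]].
  assert (Hm := Cmod_ge_0 l).
  apply filterlim_locally. intros eps.
  assert (Hq : 0 < Rmin d (eps / (2 + Cmod l))).
  { apply Rmin_glb_lt; [ easy | apply Rdiv_lt_0_compat; [ apply cond_pos | lra ] ]. }
  assert (Hball : forall w : C,
    Cmod (w - z) < Rmin d (eps / (2 + Cmod l)) -> Cmod (phi w - phi z) < eps).
  { intros w Hw.
    assert (Hwd := Rlt_le_trans _ _ _ Hw (Rmin_l _ _)).
    assert (Hweps := Rlt_le_trans _ _ _ Hw (Rmin_r _ _)).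
    apply Rlt_div_r in Hweps; [ | lra ].
    specialize (Hlin (w - z)%C). rewrite !Cnorm_Cmod in Hlin. specialize (Hlin Hwd).
    change (Cmod (phi (z + (w - z))%C - phi z - l * (w - z)) <= 1 * Cmod (w - z)) in Hlin.
    replace (z + (w - z))%C with w in Hlin by ring.
    replace (phi w - phi z)%C with ((phi w - phi z - l * (w - z)) + l * (w - z))%C by ring.
    eapply Rle_lt_trans; [ apply Cmod_triangle | ]. rewrite (Cmod_mult l).
    generalize (Cmod_ge_0 (w - z)). nra. }
  apply (locally_le_locally_norm (V := C_NormedModule)).
  exists (mkposreal _ Hq). intros w Hw.
  exact (norm_compat1 (V := C_NormedModule) _ _ _ (Hball w Hw)).
Qed.

Lemma C_IVT (g : C -> R) (z w : C) (y : R) :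
  (forall v, continuous (T := C_UniformSpace) (U := R_UniformSpace) g v) ->
  g z <= y <= g w -> exists v, g v = y.
Proof.
  intros Hg Hy.
  set (path := fun t : R => (z + RtoC t * (w - z))%C).
  assert (Hpath : forall t, continuous (T := R_UniformSpace) (U := C_UniformSpace) path t).
  { intros t. apply (continuous_plus (V := C_R_NormedModule)); [ apply continuous_const | ].
    apply continuous_ext with (fun t : R => scal (V := C_R_NormedModule) t (w - z)%C).
    { intros r. unfold scal; simpl. unfold prod_scal, scal; simpl. unfold mult; simpl.
      unfold Cmult, RtoC; simpl. f_equal; ring. }
    apply continuous_scal_l, continuous_id. }
  destruct (IVT_gen (fun t => g (path t)) 0 1 y) as [t [_ Ht]].
  - intros t. apply continuity_pt_filterlim.
    exact (continuous_comp path g t (Hpath t) (Hg (path t))).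
  - replace (path 0) with z by (unfold path; ring).
    replace (path 1) with w by (unfold path; ring).
    rewrite Rmin_left, Rmax_right; lra.
  - now exists (path t).
Qed.

Lemma cos_lt_1 t : 0 < t <= PI -> cos t < 1.
Proof. intros Ht. rewrite <- cos_0. apply cos_decreasing_1; lra. Qed.

(* [Im psi] moves continuously inside a coset of the discrete group [(2 pi / l) Z]. *)
Lemma continuous_Cexp_neg_const (l : R) (psi : C -> C) :
  0 < l -> C_continuous psi ->
  (forall z w, Cexp_neg l (psi z) = Cexp_neg l (psi w)) ->
  forall z w, psi z = psi w.
Proof.
  intros Hl Hpsi Hconst.
  assert (HIm : forall z w, Im (psi w) <= Im (psi z)).
  { intros z w. apply Rnot_lt_le. intros Hlt.
    assert (Hpi : 0 < PI / l) by (apply Rdiv_lt_0_compat; [ apply PI_RGT_0 | easy ]).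
    set (m := Rmin (Im (psi w) - Im (psi z)) (PI / l)).
    assert (Hm : 0 < m) by (apply Rmin_glb_lt; lra).
    assert (Hmw : m <= Im (psi w) - Im (psi z)) by apply Rmin_l.
    assert (Hmpi : m <= PI / l) by apply Rmin_r.
    destruct (C_IVT (fun v => Im (psi v)) z w (Im (psi z) + m)) as [v Hv]; [ | lra | ].
    { intros v. apply (continuous_comp psi Im v (Hpsi v)).
      rewrite (surjective_pairing (psi v)). apply continuous_snd. }
    destruct (Cexp_neg_eq_inv l (psi z) (psi v)) as [_ Hcos]; [ lra | apply Hconst | ].
    rewrite Hv in Hcos.
    replace (Im (psi z) + m - Im (psi z)) with m in Hcos by ring.
    apply Rle_div_r in Hmpi; [ | easy ].
    assert (cos (l * m) < 1) by (apply cos_lt_1; nra). lra. }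
  intros z w. apply injective_projections.
  - apply (Cexp_neg_eq_inv l); [ lra | apply Hconst ].
  - apply Rle_antisym; apply HIm.
Qed.

(* An exponential has no zero, hence [b0 = 0] or [b1 = 0]. *)
Lemma constant_or_shift_of_Cexp_neg_affine (l : R) (phi : C -> C) (b0 b1 : C) :
  0 < l -> C_continuous phi ->
  (forall z, Cexp_neg l (phi z) = (b0 + b1 * Cexp_neg l z)%C) ->
  is_constant phi \/ exists b, forall z, phi z = (z + b)%C.
Proof.
  intros Hl Hphi Haff.
  destruct (Ceq_dec b1 0) as [->|Hb1]; [ left | destruct (Ceq_dec b0 0) as [->|Hb0] ].
  - exists (phi 0). intros z. apply (continuous_Cexp_neg_const l phi Hl Hphi).
    intros v w. rewrite !Haff. at_C. ring.
  - right. set (psi := fun z => (phi z - z)%C).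
    assert (Hpsi : forall z w, psi z = psi w).
    { apply (continuous_Cexp_neg_const l psi Hl).
      - intros z. apply (continuous_minus (V := C_R_NormedModule));
          [ apply Hphi | apply continuous_id ].
      - assert (Hb1psi : forall z, Cexp_neg l (psi z) = b1).
        { intros z. assert (Hne := Cexp_neg_neq_0 l z).
          replace b1 with (Cexp_neg l (phi z) / Cexp_neg l z)%C
            by (rewrite Haff; field; exact Hne).
          replace (phi z) with (psi z + z)%C by (unfold psi; ring).
          rewrite Cexp_neg_plus. symmetry. at_C. field. exact Hne. }
        intros z w. now rewrite !Hb1psi. }
    exists (psi 0). intros z. rewrite (Hpsi 0 z). unfold psi.
    change (phi z = (z + (phi z - z))%C). ring.
  - exfalso. destruct (Cexp_neg_surj l (- (b0 / b1))) as [z Hz]; [ lra | | ].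
    { intros Hzero. apply Hb0. replace b0 with (- (- (b0 / b1) * b1))%C by (field; exact Hb1).
      rewrite Hzero. ring. }
    apply (Cexp_neg_neq_0 l (phi z)). rewrite Haff, Hz. at_C. field. exact Hb1.
Qed.

(** * Dirichlet series *)

Definition dterm (lam : nat -> R) (a : nat -> C) (z : C) (n : nat) : C :=
  (a n * Cexp_neg (lam n) z)%C.

Definition abs_conv (lam : nat -> R) (a : nat -> C) (x : R) : Prop :=
  ex_series (fun n => Cmod (a n) * exp (- lam n * x)).

Lemma Cmod_dterm lam a z n :
  Cmod (dterm lam a z n) = Cmod (a n) * exp (- lam n * Re z).
Proof. unfold dterm. now rewrite Cmod_mult, Cmod_Cexp_neg. Qed.

Lemma dpartial_sum_n lam a z N : dpartial lam a z N = sum_n (dterm lam a z) N.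
Proof.
  induction N as [|N IH]; [ now rewrite sum_O | ].
  rewrite sum_Sn, <- IH. reflexivity.
Qed.

Lemma dirichlet_rep_is_series lam (f : C -> C) (a : nat -> C) :
  dirichlet_rep lam f a <->
  forall z, is_series (V := C_NormedModule) (dterm lam a z) (f z).
Proof.
  split; intros Hf z; specialize (Hf z).
  - destruct Hf as [HRe HIm]. apply is_lim_seq_Reals in HRe, HIm.
    intros P [eps HP].
    assert (HeRe := proj1 (filterlim_locally _ _) HRe eps).
    assert (HeIm := proj1 (filterlim_locally _ _) HIm eps).
    refine (filter_imp (F := eventually) _ _ _ (filter_and _ _ HeRe HeIm)).
    intros N HN. apply HP. rewrite <- dpartial_sum_n. exact HN.
  - assert (Hz : forall g : C -> R, continuous (g : prod_UniformSpace _ _ -> R) (f z) ->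
      is_lim_seq (fun N => g (dpartial lam a z N)) (g (f z))).
    { intros g Hg.
      apply (is_lim_seq_ext (fun N => g (sum_n (dterm lam a z) N)));
        [ intros N; now rewrite dpartial_sum_n | ].
      exact (filterlim_comp _ _ _ _ _ _ _ _ Hf Hg). }
    split; apply is_lim_seq_Reals, (Hz _);
      rewrite (surjective_pairing (f z)); [ apply continuous_fst | apply continuous_snd ].
Qed.

Lemma dirichlet_rep_minus lam (f g : C -> C) (a b : nat -> C) :
  dirichlet_rep lam f a -> dirichlet_rep lam g b ->
  dirichlet_rep lam (fun z => f z - g z)%C (fun n => a n - b n)%C.
Proof.
  rewrite !dirichlet_rep_is_series. intros Hf Hg z.
  eapply is_series_ext; [ | exact (is_series_minus _ _ _ _ (Hf z) (Hg z)) ].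
  intros n. unfold dterm, plus, opp. at_C. ring.
Qed.

Lemma abs_conv_minus lam a b x :
  abs_conv lam a x -> abs_conv lam b x -> abs_conv lam (fun n => a n - b n)%C x.
Proof.
  intros Ha Hb.
  apply ex_series_nonneg_le with (2 := ex_series_plus (V := R_NormedModule) _ _ Ha Hb).
  intros n. unfold plus; simpl. assert (Hexp := exp_pos (- lam n * x)).
  split; [ apply Rmult_le_pos; [ apply Cmod_ge_0 | lra ] | ].
  rewrite <- Rmult_plus_distr_r. apply Rmult_le_compat_r; [ lra | ].
  rewrite <- (Cmod_opp (b n)). apply Cmod_triangle.
Qed.

Section HalfTurnAverage.

Variables (lam : nat -> R) (l h : R).

(* Averaging [F] with [z |-> kappa * F (z + i h)], where [kappa] is chosen so that
   [e^(-l z)] is left fixed, multiplies [e^(-m z)] by this factor. *)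
Definition half_turn_factor (m : R) : C :=
  (/ 2 * (1 + Cexp_neg (- l) (0, h) * Cexp_neg m (0, h)))%C.

Lemma half_turn_factor_fixed : half_turn_factor l = RtoC 1.
Proof.
  unfold half_turn_factor. rewrite <- Cexp_neg_freq_plus, Rplus_opp_l, Cexp_neg_freq_0.
  field.
Qed.

Lemma half_turn_factor_eq_0 m : (m - l) * h = PI -> half_turn_factor m = RtoC 0.
Proof.
  intros Hh. unfold half_turn_factor. rewrite <- Cexp_neg_freq_plus.
  replace (- l + m) with (m - l) by ring.
  unfold Cexp_neg, Re, Im; simpl fst; simpl snd.
  rewrite Hh, cos_PI, sin_PI, !Rmult_0_r, exp_0.
  unfold RtoC, Cmult, Cplus; simpl. f_equal; ring.
Qed.

Definition half_turn_coef (a : nat -> C) (n : nat) : C := (a n * half_turn_factor (lam n))%C.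

Lemma sum_n_half_turn a z N :
  sum_n (dterm lam (half_turn_coef a) z) N =
  (/ 2 * (sum_n (dterm lam a z) N
          + Cexp_neg (- l) (0, h) * sum_n (dterm lam a (z + (0, h))) N))%C.
Proof.
  rewrite <- (sum_n_mult_l (K := C_Ring)), <- (sum_n_plus (G := C_AbelianGroup)).
  rewrite <- (sum_n_mult_l (K := C_Ring)).
  apply sum_n_ext. intros n. unfold dterm, half_turn_coef, half_turn_factor.
  rewrite Cexp_neg_plus. unfold plus, mult; simpl. ring.
Qed.

Lemma sum_n_half_turn_bound a x B N :
  (forall z, Re z = x -> Cmod (sum_n (dterm lam a z) N) <= B) ->
  forall z, Re z = x -> Cmod (sum_n (dterm lam (half_turn_coef a) z) N) <= B.
Proof.
  intros HB z Hz.
  assert (Hhalf : Cmod (/ 2) = / 2).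
  { rewrite <- RtoC_inv, Cmod_R by lra. apply Rabs_pos_eq. lra. }
  assert (Hkappa : Cmod (Cexp_neg (- l) (0, h)) = 1).
  { rewrite Cmod_Cexp_neg. unfold Re; simpl. rewrite Rmult_0_r. apply exp_0. }
  assert (Hzh : Re (z + (0, h))%C = x) by (unfold Re, Cplus in *; simpl; lra).
  rewrite sum_n_half_turn, Cmod_mult, Hhalf.
  eapply Rle_trans; [ apply Rmult_le_compat_l; [ lra | apply Cmod_triangle ] | ].
  rewrite Cmod_mult, Hkappa. generalize (HB z Hz) (HB _ Hzh). lra.
Qed.

End HalfTurnAverage.

Section CoefficientBound.

Variables (lam : nat -> R) (n : nat) (x : R).
Hypothesis lam_simple : forall m, m <> n -> lam m <> lam n.

(* Half-turn averages that fix the [n]-th frequency remove the others one at a time. *)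
Lemma exp_sum_coef_bound (a : nat -> C) (B : R) N :
  (n <= N)%nat -> (forall z, Re z = x -> Cmod (sum_n (dterm lam a z) N) <= B) ->
  Cmod (a n) * exp (- lam n * x) <= B.
Proof.
  intros HnN.
  enough (Hrem : forall M a, (forall k, (M <= k <= N)%nat -> k <> n -> a k = RtoC 0) ->
    (forall z, Re z = x -> Cmod (sum_n (dterm lam a z) N) <= B) ->
    Cmod (a n) * exp (- lam n * x) <= B) by (apply (Hrem (S N)); lia).
  clear a. induction M as [|M IH]; intros a Ha HB.
  - specialize (HB (x, 0) eq_refl). rewrite (sum_n_single _ n) in HB.
    + now rewrite Cmod_dterm in HB.
    + easy.
    + intros k Hk Hkn. unfold dterm. rewrite Ha by (easy || lia). apply Cmult_0_l.
  - destruct (Nat.eq_dec M n) as [->|HMn].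
    { apply IH; [ | easy ]. intros k Hk Hkn. apply Ha; [ lia | easy ]. }
    assert (HlamM := lam_simple M HMn).
    set (h := PI / (lam M - lam n)).
    replace (a n) with (half_turn_coef lam (lam n) h a n)
      by (unfold half_turn_coef; now rewrite half_turn_factor_fixed, Cmult_1_r).
    apply IH; [ | now apply sum_n_half_turn_bound ].
    intros k Hk Hkn. unfold half_turn_coef. destruct (Nat.eq_dec k M) as [->|HkM].
    + rewrite half_turn_factor_eq_0 by (unfold h; field; lra). apply Cmult_0_r.
    + rewrite Ha by (easy || lia). apply Cmult_0_l.
Qed.

Lemma dirichlet_rep_coef_bound (f : C -> C) (a : nat -> C) (B : R) :
  dirichlet_rep lam f a -> abs_conv lam a x ->
  (forall z, Re z = x -> Cmod (f z) <= B) ->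
  Cmod (a n) * exp (- lam n * x) <= B.
Proof.
  intros Hf Ha HB. apply le_epsilon. intros eps Heps.
  destruct (Series_tail_small _ n eps Ha Heps) as [N [HnN HN]].
  apply (exp_sum_coef_bound a (B + eps) N HnN). intros z Hz.
  rewrite <- Hz in Ha, HN.
  assert (Htail : Cmod (f z - sum_n (dterm lam a z) N) <= eps).
  { eapply Rle_trans; [ | exact HN ].
    eapply (is_series_norm_le (V := C_NormedModule) (fun k => dterm lam a z (S N + k)%nat)).
    - intros k. apply Req_le, Cmod_dterm.
    - apply (is_series_tail (V := C_NormedModule) (dterm lam a z)).
      now apply dirichlet_rep_is_series.
    - apply Series_correct. now apply (ex_series_incr_n _ (S N)) in Ha. }
  replace (sum_n (dterm lam a z) N) with (f z - (f z - sum_n (dterm lam a z) N))%C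
    by (at_C; ring).
  eapply Rle_trans; [ apply Cmod_triangle | ]. rewrite Cmod_opp.
  specialize (HB z Hz). lra.
Qed.

End CoefficientBound.

Section Frequencies.

Variable lam : nat -> R.
Hypothesis Hlam : frequencies lam.

Lemma frequencies_lt m n : (m < n)%nat -> lam m < lam n.
Proof.
  destruct Hlam as [_ [Hstep _]]. induction 1; [ apply Hstep | ].
  eapply Rlt_trans; [ eassumption | apply Hstep ].
Qed.

Lemma frequencies_neq m n : m <> n -> lam m <> lam n.
Proof.
  intros Hmn. destruct (Nat.lt_total m n) as [Hlt|[Heq|Hgt]]; [ | easy | ].
  - generalize (frequencies_lt _ _ Hlt). lra.
  - generalize (frequencies_lt _ _ Hgt). lra.
Qed.

Lemma frequencies_nonneg n : 0 <= lam n.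
Proof.
  destruct n as [|n]; [ apply Hlam | ].
  generalize (frequencies_lt 0 (S n) (Nat.lt_0_succ n)). destruct Hlam. lra.
Qed.

Lemma frequencies_pos n : (0 < n)%nat -> 0 < lam n.
Proof. intros Hn. generalize (frequencies_lt 0 n Hn) (frequencies_nonneg 0). lra. Qed.

End Frequencies.

(** * The weighted space and its reproducing kernel *)

Section WeightedSpace.

Variables lam beta : nat -> R.
Hypothesis Hlam : frequencies lam.
Hypothesis HE : condE lam beta.

Lemma beta_pos n : 0 < beta n.
Proof. apply HE. Qed.

Lemma exp_div_beta_le_inv x :
  exists N, forall n, (N <= n)%nat -> exp (- lam n * x) / beta n <= / INR (S n).
Proof.
  destruct Hlam as [_ [_ [_ [M [N0 HM]]]]].
  destruct HE as [_ Hinf]. destruct (Hinf (M - x)) as [N1 HN1].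
  exists (S (N0 + N1)). intros n Hn.
  assert (Hlamn : 0 < lam n) by (apply (frequencies_pos lam Hlam); lia).
  specialize (HM n ltac:(lia)). specialize (HN1 n ltac:(lia)).
  apply Rle_div_l in HM; [ | easy ]. apply Rle_div_r in HN1; [ | easy ].
  rewrite <- (exp_ln (beta n)) by apply beta_pos.
  rewrite <- (exp_ln (INR (S n))) by (apply lt_0_INR; lia).
  unfold Rdiv. rewrite <- !exp_Ropp, <- exp_plus. apply exp_le. lra.
Qed.

(* Its sum is the squared norm of the reproducing kernel at any point of real part [x]. *)
Definition kernel_term (x : R) (n : nat) : R := (exp (- lam n * x) / beta n) ^ 2.

Definition kernel_normsq (x : R) : R := Series (kernel_term x).

Lemma kernel_term_pos x n : 0 < kernel_term x n.
Proof. apply pow_lt, Rdiv_lt_0_compat; [ apply exp_pos | apply beta_pos ]. Qed.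

Lemma kernel_term_nonneg x n : 0 <= kernel_term x n.
Proof. left. apply kernel_term_pos. Qed.

Lemma ex_series_kernel_term x : ex_series (kernel_term x).
Proof.
  destruct (exp_div_beta_le_inv x) as [N HN].
  apply (ex_series_incr_n _ N).
  apply ex_series_nonneg_le with (fun k => (/ INR (S (N + k))) ^ 2).
  - intros k. split; [ apply kernel_term_nonneg | apply pow_incr; split ].
    + left. apply Rdiv_lt_0_compat; [ apply exp_pos | apply beta_pos ].
    + apply HN. lia.
  - apply (ex_series_incr_n (fun n => (/ INR (S n)) ^ 2) N), ex_series_inv_sqr.
Qed.

Lemma kernel_normsq_pos x : 0 < kernel_normsq x.
Proof.
  eapply Rlt_le_trans; [ apply (kernel_term_pos x 0) | ].
  exact (sum_f_R0_le_Series _ 0 (kernel_term_nonneg x) (ex_series_kernel_term x)).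
Qed.

Definition expansion (f : C -> C) (a : nat -> C) (s : R) : Prop :=
  dirichlet_rep lam f a /\ coef_normsq beta a s.

Lemma coef_normsq_is_series (a : nat -> C) s :
  coef_normsq beta a s <-> is_series (fun n => (Cmod (a n) * beta n) ^ 2) s.
Proof.
  unfold coef_normsq. rewrite <- is_series_Reals.
  split; apply is_series_ext; intros n; rewrite Cnorm2_Cmod, Rpow_mult_distr; easy.
Qed.

Lemma Cmod_dterm_beta (a : nat -> C) z n :
  Cmod (dterm lam a z n) = (Cmod (a n) * beta n) * (exp (- lam n * Re z) / beta n).
Proof. rewrite Cmod_dterm. field. generalize (beta_pos n). lra. Qed.

Lemma coef_normsq_abs_conv (a : nat -> C) s x : coef_normsq beta a s -> abs_conv lam a x.
Proof.
  intros Ha. apply coef_normsq_is_series in Ha.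
  eapply ex_series_ext;
    [ | exact (ex_series_mult_sqr _ _ (ex_intro _ s Ha) (ex_series_kernel_term x)) ].
  intros n. transitivity (Cmod (dterm lam a (x, 0) n));
    [ symmetry; apply Cmod_dterm_beta | apply Cmod_dterm ].
Qed.

Lemma expansion_eval_le f a s z :
  expansion f a s -> Cmod (f z) <= sqrt s * sqrt (kernel_normsq (Re z)).
Proof.
  intros [Hf Ha]. assert (Habs := coef_normsq_abs_conv a s (Re z) Ha).
  apply coef_normsq_is_series in Ha. rewrite <- (is_series_unique _ _ Ha).
  eapply Rle_trans;
    [ | exact (Series_Cauchy_Schwarz _ _ (ex_intro _ s Ha) (ex_series_kernel_term (Re z))) ].
  apply (is_series_norm_le (V := C_NormedModule) (dterm lam a z)
    (fun n => (Cmod (a n) * beta n) * (exp (- lam n * Re z) / beta n))).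
  - intros n. apply Req_le, Cmod_dterm_beta.
  - now apply dirichlet_rep_is_series.
  - apply Series_correct. eapply ex_series_ext; [ | exact Habs ].
    intros n. now rewrite <- Cmod_dterm_beta, Cmod_dterm.
Qed.

Lemma expansion_coef_unique f a s b t :
  expansion f a s -> expansion f b t -> forall n, a n = b n.
Proof.
  intros [Hfa Ha] [Hfb Hb] n.
  assert (Hzero : Cmod (a n - b n) * exp (- lam n * 0) <= 0).
  { apply (dirichlet_rep_coef_bound lam n 0 (fun m => frequencies_neq lam Hlam m n)
             (fun z => f z - f z)%C (fun k => a k - b k)%C).
    - now apply dirichlet_rep_minus.
    - apply abs_conv_minus; eapply coef_normsq_abs_conv; eassumption.
    - intros z _. unfold Cminus. rewrite Cplus_opp_r, Cmod_0. lra. }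
  rewrite Rmult_0_r, exp_0, Rmult_1_r in Hzero.
  assert (Hdiff : (a n - b n)%C = RtoC 0).
  { apply Cmod_eq_0. generalize (Cmod_ge_0 (a n - b n)). lra. }
  replace (a n) with (a n - b n + b n)%C by ring. rewrite Hdiff. ring.
Qed.

Lemma expansion_normsq_unique f a s b t : expansion f a s -> expansion f b t -> s = t.
Proof.
  intros Ha Hb. assert (Hab := expansion_coef_unique _ _ _ _ _ Ha Hb).
  destruct Ha as [_ Ha], Hb as [_ Hb]. apply coef_normsq_is_series in Ha, Hb.
  apply (is_series_limit_unique (V := R_NormedModule) _ _ _ Ha).
  eapply is_series_ext; [ | exact Hb ]. intros n. now rewrite Hab.
Qed.

Lemma expansion_coef_eq_0 f a s mu A r n :
  expansion f a s -> mu < lam n ->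
  (forall z, Re z <= r -> Cmod (f z) <= A * exp (- mu * Re z)) -> a n = RtoC 0.
Proof.
  intros [Hf Ha] Hmu Hgrowth. apply Cmod_eq_0, Rle_antisym; [ | apply Cmod_ge_0 ].
  apply (exp_dominated_le_0 _ A (lam n - mu) r); [ lra | ].
  intros x Hx. apply Rmult_le_reg_r with (exp (- lam n * x)); [ apply exp_pos | ].
  replace (A * _ * _) with (A * exp (- mu * x))
    by (rewrite Rmult_assoc, <- exp_plus; do 2 f_equal; ring).
  apply (dirichlet_rep_coef_bound lam n x (fun m => frequencies_neq lam Hlam m n) f a).
  - easy.
  - now apply coef_normsq_abs_conv with s.
  - intros z Hz. rewrite <- Hz. apply Hgrowth. lra.
Qed.

Lemma expansion_ext f g a s : (forall z, f z = g z) -> expansion f a s -> expansion g a s.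
Proof. intros Hfg [Hf Ha]. split; [ | easy ]. intros z. rewrite <- Hfg. apply Hf. Qed.

Definition single_coef (k : nat) (c : C) (n : nat) : C := if Nat.eq_dec n k then c else RtoC 0.

Lemma expansion_single k c :
  expansion (fun z => c * Cexp_neg (lam k) z)%C (single_coef k c) ((Cmod c * beta k) ^ 2).
Proof.
  assert (Hk : single_coef k c k = c) by (unfold single_coef; now destruct (Nat.eq_dec k k)).
  assert (Hne : forall n, n <> k -> single_coef k c n = RtoC 0)
    by (intros n Hn; unfold single_coef; now destruct (Nat.eq_dec n k)).
  split.
  - apply dirichlet_rep_is_series. intros z.
    replace (Cmult c _) with (dterm lam (single_coef k c) z k)
      by (unfold dterm; now rewrite Hk).
    apply (is_series_single (V := C_NormedModule) (dterm lam (single_coef k c) z)).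
    intros n Hn. unfold dterm. rewrite Hne by easy. apply Cmult_0_l.
  - apply coef_normsq_is_series.
    replace (Cmod c) with (Cmod (single_coef k c k)) by now rewrite Hk.
    apply (is_series_single (V := R_NormedModule)
      (fun n => (Cmod (single_coef k c n) * beta n) ^ 2)).
    intros n Hn. rewrite Hne by easy. rewrite Cmod_0, Rmult_0_l. apply pow_ne_zero. lia.
Qed.

Lemma expansion_exists (a : nat -> C) s : coef_normsq beta a s -> exists f, expansion f a s.
Proof.
  intros Ha.
  set (f := fun z => iota (T := C_CompleteNormedModule)
                       (is_series (V := C_NormedModule) (dterm lam a z)) : C).
  exists f. split; [ | easy ]. apply dirichlet_rep_is_series. intros z.
  destruct (ex_series_le (V := C_CompleteNormedModule) (dterm lam a z) _
    (fun n => Req_le _ _ (Cmod_dterm lam a z n)) (coef_normsq_abs_conv a s (Re z) Ha))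
    as [l Hl].
  replace (f z) with l; [ exact Hl | symmetry ].
  exact (iota_filterlim_locally (F := eventually) (sum_n (dterm lam a z)) l Hl).
Qed.

Definition kernel_coef (u : C) (n : nat) : C :=
  (Cconj (Cexp_neg (lam n) u) * RtoC (/ beta n ^ 2))%C.

Lemma kernel_expansion u :
  exists k, expansion k (kernel_coef u) (kernel_normsq (Re u))
    /\ k u = RtoC (kernel_normsq (Re u)).
Proof.
  destruct (expansion_exists (kernel_coef u) (kernel_normsq (Re u))) as [k [Hk Hnorm]].
  { apply coef_normsq_is_series.
    apply is_series_ext with (kernel_term (Re u));
      [ | apply Series_correct, ex_series_kernel_term ].
    intros n. assert (Hb := beta_pos n). unfold kernel_coef, kernel_term.
    rewrite Cmod_mult, Cmod_conj, Cmod_Cexp_neg, Cmod_R, Rabs_pos_eq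
      by (left; apply Rinv_0_lt_compat, pow_lt, Hb).
    f_equal. field. lra. }
  exists k. split; [ now split | ].
  apply (is_series_limit_unique (V := C_NormedModule) (dterm lam (kernel_coef u) u));
    [ now apply dirichlet_rep_is_series | ].
  apply is_series_ext with (fun n => RtoC (kernel_term (Re u) n));
    [ | apply is_series_RtoC, Series_correct, ex_series_kernel_term ].
  intros n. unfold dterm, kernel_coef, kernel_term.
  replace (Cmult _ _) with
    (Cconj (Cexp_neg (lam n) u) * Cexp_neg (lam n) u * RtoC (/ beta n ^ 2))%C by ring.
  rewrite Cexp_neg_conj_mult, <- RtoC_mult. f_equal. field.
  generalize (beta_pos n). lra.
Qed.

Lemma kernel_term_shift x x' n :
  exp (2 * lam n * (x - x')) * kernel_term x n = kernel_term x' n.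
Proof.
  unfold kernel_term, Rdiv. rewrite !Rpow_mult_distr, <- Rmult_assoc. f_equal.
  simpl. rewrite !Rmult_1_r, <- !exp_plus. f_equal. ring.
Qed.

Lemma kernel_normsq_shift_le x x' :
  x' <= x ->
  exp (2 * lam 1%nat * (x - x')) * (kernel_normsq x - kernel_term x 0) <= kernel_normsq x'.
Proof.
  intros Hx. unfold kernel_normsq.
  rewrite (Series_incr_1 _ (ex_series_kernel_term x)).
  rewrite (Series_incr_1 _ (ex_series_kernel_term x')).
  assert (Htail : forall y, ex_series (fun n => kernel_term y (S n))).
  { intros y. apply (ex_series_incr_1 (kernel_term y)), ex_series_kernel_term. }
  replace (_ + _ - _) with (Series (fun n => kernel_term x (S n))) by ring.
  rewrite <- Series_scal_l. eapply Rle_trans; [ apply Series_le; [ | apply (Htail x') ] | ].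
  - intros n. split.
    + apply Rmult_le_pos; [ left; apply exp_pos | apply kernel_term_nonneg ].
    + rewrite <- (kernel_term_shift x x' (S n)).
      apply Rmult_le_compat_r; [ apply kernel_term_nonneg | ]. apply exp_le.
      assert (lam 1%nat <= lam (S n)); [ | nra ].
      destruct n as [|n]; [ lra | left; apply (frequencies_lt lam Hlam); lia ].
  - generalize (kernel_term_nonneg x' 0). lra.
Qed.

Lemma kernel_term_0_le_half :
  exists r, forall x, x <= r -> 2 * kernel_term x 0 <= kernel_normsq x.
Proof.
  assert (Hlam01 := frequencies_lt lam Hlam 0 1 Nat.lt_0_1).
  exists ((ln (kernel_term 0 1) - ln (kernel_term 0 0)) / (2 * (lam 1%nat - lam 0%nat))).
  intros x Hx. apply Rle_div_r in Hx; [ | lra ].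
  assert (Hterm : kernel_term x 0 <= kernel_term x 1).
  { rewrite <- (kernel_term_shift 0 x 0), <- (kernel_term_shift 0 x 1).
    rewrite <- (exp_ln (kernel_term 0 0)) by apply kernel_term_pos.
    rewrite <- (exp_ln (kernel_term 0 1)) by apply kernel_term_pos.
    rewrite <- !exp_plus. apply exp_le. lra. }
  assert (Hsum : kernel_term x 0 + kernel_term x 1 <= kernel_normsq x)
    by exact (sum_f_R0_le_Series _ 1 (kernel_term_nonneg x) (ex_series_kernel_term x)).
  lra.
Qed.

(** * Composition operators *)

Definition comp_norm_le (phi : C -> C) (K : R) : Prop :=
  forall f a s b t,
    dirichlet_rep lam f a -> coef_normsq beta a s ->
    dirichlet_rep lam (fun z => f (phi z)) b -> coef_normsq beta b t ->
    sqrt t <= K * sqrt s.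

Lemma comp_norm_le_upper_bound phi K :
  comp_norm_le phi K -> is_upper_bound (comp_ratios lam beta phi) K.
Proof.
  intros HK r [f [a [s [b [t [Hf [Ha [Hs [Hfb [Hb ->]]]]]]]]]].
  apply Rle_div_l; [ now apply sqrt_lt_R0 | ]. exact (HK f a s b t Hf Ha Hfb Hb).
Qed.

(* Test [C_phi] on the reproducing kernel at [phi w]. *)
Lemma comp_bounded_kernel_normsq_le phi :
  comp_bounded lam beta phi ->
  exists M, 0 <= M /\ forall w, kernel_normsq (Re (phi w)) <= M * kernel_normsq (Re w).
Proof.
  intros [Hstable [K HK]]. exists (K ^ 2). split; [ apply pow2_ge_0 | ]. intros w.
  destruct (kernel_expansion (phi w)) as [k [Hk Hkw]].
  destruct (Hstable k) as [b [t Hkb]]; [ do 2 eexists; exact Hk | ].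
  assert (Hnorm := HK k _ _ b t (proj1 Hk) (proj2 Hk) (proj1 Hkb) (proj2 Hkb)).
  assert (Heval := expansion_eval_le _ b t w Hkb). simpl in Heval.
  rewrite Hkw, Cmod_R, Rabs_pos_eq in Heval by (left; apply kernel_normsq_pos).
  set (V := kernel_normsq (Re (phi w))) in *. set (W := kernel_normsq (Re w)) in *.
  assert (HV : 0 < V) by apply kernel_normsq_pos.
  assert (HW : 0 < W) by apply kernel_normsq_pos.
  assert (HsqrtV := sqrt_lt_R0 V HV). assert (HsqrtW := sqrt_lt_R0 W HW).
  assert (Hsqrt : sqrt V <= K * sqrt W).
  { apply Rmult_le_reg_r with (sqrt V); [ easy | ]. rewrite sqrt_sqrt by lra.
    eapply Rle_trans; [ exact Heval | ]. nra. }
  rewrite <- (pow2_sqrt V), <- (pow2_sqrt W), <- Rpow_mult_distr by lra.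
  apply pow_incr. lra.
Qed.

Lemma comp_bounded_Re_ge phi :
  comp_bounded lam beta phi -> exists r D, forall w, Re w <= r -> Re w - D <= Re (phi w).
Proof.
  intros Hphi. destruct (comp_bounded_kernel_normsq_le phi Hphi) as [M [HM Hkernel]].
  destruct kernel_term_0_le_half as [r Hr].
  assert (Hlam1 := frequencies_pos lam Hlam 1 Nat.lt_0_1).
  exists r, (ln (2 * M + 1) / (2 * lam 1%nat)). intros w Hw.
  assert (HD : 0 <= ln (2 * M + 1) / (2 * lam 1%nat)).
  { apply Rdiv_le_0_compat; [ rewrite <- ln_1; apply ln_le | ]; lra. }
  destruct (Rle_lt_dec (Re w) (Re (phi w))) as [Hle|Hlt]; [ lra | ].
  set (d := Re w - Re (phi w)). set (W := kernel_normsq (Re w)).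
  assert (Hexp : exp (2 * lam 1%nat * d) <= 2 * M + 1).
  { assert (Hshift := kernel_normsq_shift_le (Re w) (Re (phi w)) (Rlt_le _ _ Hlt)).
    specialize (Hkernel w). specialize (Hr (Re w) Hw).
    fold d W in Hshift. fold W in Hkernel, Hr.
    assert (HW : 0 < W) by apply kernel_normsq_pos.
    assert (Hhalf : exp (2 * lam 1%nat * d) * (W / 2) <= M * W).
    { eapply Rle_trans; [ | eapply Rle_trans; [ exact Hshift | exact Hkernel ] ].
      apply Rmult_le_compat_l; [ left; apply exp_pos | lra ]. }
    apply Rmult_le_reg_r with (W / 2); [ lra | nra ]. }
  apply ln_le in Hexp; [ | apply exp_pos ]. rewrite ln_exp in Hexp.
  enough (d <= ln (2 * M + 1) / (2 * lam 1%nat)) by (unfold d in *; lra).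
  apply Rle_div_r; lra.
Qed.

Lemma comp_bounded_Cexp_neg_comp phi :
  comp_bounded lam beta phi ->
  exists b0 b1 : C, forall z,
    Cexp_neg (lam 1%nat) (phi z)
    = (b0 * Cexp_neg (lam 0%nat) z + b1 * Cexp_neg (lam 1%nat) z)%C.
Proof.
  intros Hphi. destruct (comp_bounded_Re_ge phi Hphi) as [r [D Hre]].
  assert (Hlam1 := frequencies_pos lam Hlam 1 Nat.lt_0_1).
  set (l := lam 1%nat) in *.
  destruct (proj1 Hphi (fun z => 1 * Cexp_neg l z)%C) as [b [t Hb]];
    [ eexists; eexists; apply (expansion_single 1) | ].
  assert (Hb0 : forall n, (1 < n)%nat -> b n = RtoC 0).
  { intros n Hn. apply (expansion_coef_eq_0 _ b t l (exp (l * D)) r n Hb).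
    - now apply (frequencies_lt lam Hlam).
    - intros z Hz. rewrite Cmult_1_l, Cmod_Cexp_neg, <- exp_plus. apply exp_le.
      specialize (Hre z Hz). nra. }
  exists (b 0%nat), (b 1%nat). intros z.
  rewrite <- (Cmult_1_l (Cexp_neg l (phi z))).
  apply (is_series_limit_unique (V := C_NormedModule) (dterm lam b z)).
  - exact (proj1 (dirichlet_rep_is_series lam _ b) (proj1 Hb) z).
  - replace (Cplus _ _) with (sum_n (G := C_NormedModule) (dterm lam b z) 1)
      by now rewrite sum_Sn, sum_O.
    apply is_series_finite_support. intros n Hn. unfold dterm. rewrite Hb0 by easy.
    apply Cmult_0_l.
Qed.

Lemma comp_bounded_shift_Re_nonneg (phi : C -> C) (b : C) :
  comp_bounded lam beta phi -> (forall z, phi z = (z + b)%C) -> 0 <= Re b.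
Proof.
  intros [_ [K HK]] Hphi. apply Rnot_lt_le. intros Hneg.
  assert (Hexp : forall k, exp (- lam k * Re b) <= K).
  { intros k. assert (Hbeta := beta_pos k).
    destruct (expansion_single k 1) as [Hf Hs].
    assert (Hcomp : expansion (fun z => 1 * Cexp_neg (lam k) (phi z))%C
      (single_coef k (Cexp_neg (lam k) b)) ((Cmod (Cexp_neg (lam k) b) * beta k) ^ 2)).
    { apply expansion_ext with (2 := expansion_single k _).
      intros z. rewrite Hphi, Cexp_neg_plus. ring. }
    assert (Hratio := HK _ _ _ _ _ Hf Hs (proj1 Hcomp) (proj2 Hcomp)).
    rewrite Cmod_1, Cmod_Cexp_neg, !sqrt_pow2 in Hratio
      by (apply Rmult_le_pos; [ try (left; apply exp_pos) | ]; lra).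
    apply Rmult_le_reg_r with (beta k); lra. }
  destruct Hlam as [_ [_ [Hinf _]]].
  destruct (Hinf (ln K / - Re b)) as [N HN]. specialize (HN N (le_n _)).
  apply Rlt_div_l in HN; [ | lra ].
  specialize (Hexp N). apply ln_le in Hexp; [ | apply exp_pos ]. rewrite ln_exp in Hexp. lra.
Qed.

Lemma expansion_shift f a s b :
  0 <= Re b -> expansion f a s ->
  exists a' t, expansion (fun z => f (z + b)%C) a' t /\ t <= s.
Proof.
  intros Hb [Hf Ha]. apply coef_normsq_is_series in Ha.
  set (a' := fun n => (a n * Cexp_neg (lam n) b)%C).
  assert (Hle : forall n, 0 <= (Cmod (a' n) * beta n) ^ 2 <= (Cmod (a n) * beta n) ^ 2).
  { intros n. split; [ apply pow2_ge_0 | ]. unfold a'. rewrite Cmod_mult, Cmod_Cexp_neg.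
    assert (Hexp : exp (- lam n * Re b) <= 1).
    { rewrite <- exp_0. apply exp_le. generalize (frequencies_nonneg lam Hlam n). nra. }
    assert (Hcoef := Cmod_ge_0 (a n)). assert (Hbeta := beta_pos n).
    assert (Hpos := exp_pos (- lam n * Re b)).
    apply pow_incr. split; [ repeat apply Rmult_le_pos; lra | ].
    apply Rmult_le_compat_r; [ lra | nra ]. }
  assert (Hex : ex_series (fun n => (Cmod (a' n) * beta n) ^ 2)).
  { apply ex_series_nonneg_le with (1 := Hle). now exists s. }
  exists a', (Series (fun n => (Cmod (a' n) * beta n) ^ 2)). split; [ split | ].
  - apply dirichlet_rep_is_series. intros z.
    apply is_series_ext with (dterm lam a (z + b)%C); [ | now apply dirichlet_rep_is_series ].
    intros n. unfold dterm, a'. rewrite Cexp_neg_plus. at_C. ring.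
  - now apply coef_normsq_is_series, Series_correct.
  - rewrite <- (is_series_unique _ _ Ha). apply Series_le; [ exact Hle | now exists s ].
Qed.

Lemma comp_norm_le_translation phi : is_translation phi -> comp_norm_le phi 1.
Proof.
  intros [c [Hc Hphi]] f a s b t Hf Ha Hfb Hb.
  destruct (expansion_shift f a s c Hc (conj Hf Ha)) as [a' [t' [Ha' Ht']]].
  replace t with t'; [ rewrite Rmult_1_l; now apply sqrt_le_1_alt | ].
  apply (expansion_normsq_unique (fun z => f (z + c)%C) a' t' b); [ easy | ].
  apply expansion_ext with (2 := conj Hfb Hb). intros z. now rewrite Hphi.
Qed.

Lemma comp_bounded_translation phi : is_translation phi -> comp_bounded lam beta phi.
Proof.
  intros Hphi. split; [ | exists 1; now apply comp_norm_le_translation ].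
  destruct Hphi as [c [Hc Hphi]]. intros f [a [s Hf]].
  destruct (expansion_shift f a s c Hc Hf) as [a' [t [Ha' _]]].
  exists a', t. apply expansion_ext with (2 := Ha'). intros z. now rewrite Hphi.
Qed.

Section ZeroFrequency.

Hypothesis lam_0 : lam 0%nat = 0.

Lemma expansion_constant c :
  expansion (fun _ => c) (single_coef 0 c) ((Cmod c * beta 0%nat) ^ 2).
Proof.
  apply expansion_ext with (2 := expansion_single 0 c).
  intros z. rewrite lam_0, Cexp_neg_freq_0. apply Cmult_1_r.
Qed.

Lemma expansion_comp_constant (f phi : C -> C) c :
  (forall z, phi z = c) ->
  expansion (fun z => f (phi z)) (single_coef 0 (f c)) ((Cmod (f c) * beta 0%nat) ^ 2).
Proof.
  intros Hphi. apply expansion_ext with (2 := expansion_constant (f c)).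
  intros z. now rewrite Hphi.
Qed.

Lemma comp_norm_le_constant (phi : C -> C) c :
  (forall z, phi z = c) -> comp_norm_le phi (beta 0%nat * sqrt (kernel_normsq (Re c))).
Proof.
  intros Hphi f a s b t Hf Ha Hfb Hb. assert (Hbeta := beta_pos 0).
  assert (Hcomp := expansion_comp_constant f phi c Hphi).
  rewrite (expansion_normsq_unique _ _ _ _ _ (conj Hfb Hb) Hcomp).
  rewrite sqrt_pow2 by (apply Rmult_le_pos; [ apply Cmod_ge_0 | lra ]).
  generalize (expansion_eval_le f a s c (conj Hf Ha)). nra.
Qed.

Lemma comp_bounded_constant phi : is_constant phi -> comp_bounded lam beta phi.
Proof.
  intros [c Hphi]. split.
  - intros f _. eexists. eexists. apply (expansion_comp_constant f phi c Hphi).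
  - eexists. apply (comp_norm_le_constant phi c Hphi).
Qed.

Lemma comp_ratios_1 phi : comp_ratios lam beta phi 1.
Proof.
  assert (Hs : 0 < (Cmod 1 * beta 0%nat) ^ 2).
  { rewrite Cmod_1, Rmult_1_l. apply pow_lt, beta_pos. }
  destruct (expansion_constant 1) as [Hf Ha].
  exists (fun _ => RtoC 1), (single_coef 0 1), ((Cmod 1 * beta 0%nat) ^ 2),
    (single_coef 0 1), ((Cmod 1 * beta 0%nat) ^ 2).
  repeat (split; [ assumption | ]).
  symmetry. apply Rdiv_diag. generalize (sqrt_lt_R0 _ Hs). lra.
Qed.

Lemma comp_bounded_is_lub_ge_1 phi :
  comp_bounded lam beta phi -> exists c, is_lub (comp_ratios lam beta phi) c /\ 1 <= c.
Proof.
  intros [_ [K HK]].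
  destruct (completeness (comp_ratios lam beta phi)) as [c Hc].
  - exists K. now apply comp_norm_le_upper_bound.
  - exists 1. apply comp_ratios_1.
  - exists c. split; [ exact Hc | apply Hc, comp_ratios_1 ].
Qed.

Lemma is_lub_translation phi : is_translation phi -> is_lub (comp_ratios lam beta phi) 1.
Proof.
  intros Hphi. split.
  - now apply comp_norm_le_upper_bound, comp_norm_le_translation.
  - intros K HK. apply HK, comp_ratios_1.
Qed.

Lemma comp_bounded_constant_or_translation phi :
  entire phi -> comp_bounded lam beta phi -> is_constant phi \/ is_translation phi.
Proof.
  intros Hentire Hphi.
  destruct (comp_bounded_Cexp_neg_comp phi Hphi) as [b0 [b1 Haff]].
  destruct (constant_or_shift_of_Cexp_neg_affine (lam 1%nat) phi b0 b1) as [Hc|[b Hb]].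
  - apply (frequencies_pos lam Hlam). lia.
  - now apply entire_continuous.
  - intros z. rewrite Haff, lam_0, Cexp_neg_freq_0. at_C. ring.
  - now left.
  - right. exists b. split; [ now apply (comp_bounded_shift_Re_nonneg phi) | easy ].
Qed.

End ZeroFrequency.

End WeightedSpace.

Theorem theorem4p7 (lam beta : nat -> R) (phi : Cplx -> Cplx)
  (Hlam : frequencies lam) (Hlam0 : lam 0%nat = 0) (HE : condE lam beta)
  (Hphi : entire phi) :
  (comp_bounded lam beta phi <-> (is_constant phi \/ is_translation phi)) /\
  (is_constant phi -> exists c : R, is_lub (comp_ratios lam beta phi) c /\ 1 <= c) /\
  (is_translation phi -> is_lub (comp_ratios lam beta phi) 1).
Proof.
  split; [ split | split ].
  - now apply comp_bounded_constant_or_translation.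
  - intros [Hconst|Htrans];
      [ now apply comp_bounded_constant | now apply comp_bounded_translation ].
  - intros Hconst. now apply comp_bounded_is_lub_ge_1, comp_bounded_constant.
  - now apply is_lub_translation.
Qed.
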